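(* Let $G=(L,R,E)$ be a finite bipartite graph whose vertex set $R$ is equipped with a linear ordering. Then for every matching $M$ in $G$ there exists a linear ordering $\succ$ of the vertices of $L$ such that the order of the greedy matching $M^\succ_G$ is less than or equal to the order of $M$ (in particular, if $M$ is $L$-saturating then so is $M^\succ_G$).
   Context: Let $y_1\succ y_2\succ\dots\succ y_N$ be the vertices of $R$ listed in order of preference. A matching $M$ is $L$-saturating if every vertex of $L$ is matched by $M$. The order of a matching $M$ is the smallest $k$ such that $M$ is $L$-saturating and leaves $y_{k+1},\dots,y_N$ unmatched; if $M$ is not $L$-saturating its order is $\infty$. Given a linear ordering $\succ$ of $L$, the greedy matching $M^\succ_G$ is the matching produced by the following procedure: start with $M=\emptyset$; while $M$ is not a maximal matching, let $L_M$ be the set of vertices of $L$ unmatched by $M$ that are adjacent to some vertex of $R$ unmatched by $M$, $R_M$ analogously, let $x^*$ be the most preferred vertex of $L_M$, let $y^*$ be the most preferred vertex of $R_M$ adjacent to $x^*$, and add the edge $\{x^*,y^*\}$ to $M$; return $M$ when it is maximal. *)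

(* Defs.v *)
From mathcomp Require Import all_boot.

Set Implicit Arguments.
Unset Strict Implicit.
Unset Printing Implicit Defensive.

(* [r x y] reads "x is preferred to y". *)
Definition strict_linear_order (T : eqType) (r : rel T) : Prop :=
  [/\ irreflexive r, transitive r & forall x y, x != y -> r x y || r y x].

Definition most_preferred (T : finType) (r : rel T) (A : {set T}) : option T :=
  [pick x in A | [forall z in A, (z != x) ==> r x z]].

(* The index i such that y = y_i when y_1, y_2, ..., y_N lists the elements of
   T from most to least preferred. *)
Definition pref_index (T : finType) (r : rel T) (y : T) : nat :=
  #|[set z | (z == y) || r z y]|.

(* Order of values in nat extended with infinity, encoded as None. *)
Definition le_ext (a b : option nat) : bool :=
  match a, b with
  | _, None => true
  | None, Some _ => false
  | Some m, Some n => m <= n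
  end.

(* A bipartite graph (L, R, E) is given by its parts L and R and by its edge set
   E : {set L * R}; a set of edges M : {set L * R} may be a matching or not. *)
Section Matchings.
Variables L R : finType.
Implicit Types (E M : {set L * R}) (rL : rel L) (rR : rel R).

Definition matching E : pred {set L * R} := fun M =>
  (M \subset E) &&
  [forall e in M, forall f in M,
     ((e.1 == f.1) || (e.2 == f.2)) ==> (e == f)].

Definition maximal_matching E M : bool := maxset (matching E) M.

Definition matchedL M : {set L} := [set e.1 | e in M].
Definition matchedR M : {set R} := [set e.2 | e in M].

Definition saturating M : bool := [forall x : L, x \in matchedL M].

Definition unmatched_beyond rR M : pred nat := fun k =>
  [forall y : R, (k < pref_index rR y) ==> (y \notin matchedR M)].

Lemma unmatched_beyond_ex rR M : exists k, unmatched_beyond rR M k.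
Proof.
exists #|R|; apply/forallP => y; apply/implyP.
by rewrite ltnNge max_card.
Qed.

Definition matching_order rR M : option nat :=
  if saturating M then Some (ex_minn (unmatched_beyond_ex rR M)) else None.

Definition availL E M : {set L} :=
  [set x | (x \notin matchedL M) &&
           [exists y, (y \notin matchedR M) && ((x, y) \in E)]].
Definition availR E M : {set R} :=
  [set y | (y \notin matchedR M) &&
           [exists x, (x \notin matchedL M) && ((x, y) \in E)]].

Definition greedy_step E rL rR M : {set L * R} :=
  if maximal_matching E M then M else
  if most_preferred rL (availL E M) is Some x then
    if most_preferred rR [set y in availR E M | (x, y) \in E] is Some y
    then (x, y) |: M else M
  else M.

(* Each step that does not stop matches a new vertex of L, so #|L| steps run
   the loop to its end; greedy_matching_maximal below checks this. *)
Definition greedy_matching E rL rR : {set L * R} :=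
  iter #|L| (greedy_step E rL rR) set0.

End Matchings.

Lemma most_preferred_ex (T : finType) (r : rel T) (A : {set T}) :
  strict_linear_order r -> A != set0 ->
  exists2 x, most_preferred r A = Some x & x \in A.
Proof.
move=> [irr tr tot] /set0Pn[a aA].
rewrite /most_preferred; case: pickP => [x /andP[xA _]|no]; first by exists x.
case: (@arg_minnP T a (mem A) (fun x => #|[set z in A | r z x]|) aA) => x xA xmin.
have /negbT := no x; rewrite /= [x \in A]xA /= => /forallPn[z].
rewrite !negb_imply => /and3P[zA zx nxz].
have rzx : r z x by have := tot z x zx; rewrite (negbTE nxz) orbF.
have : #|[set w in A | r w z]| < #|[set w in A | r w x]|.
  apply: proper_card; apply/properP; split.
    by apply/subsetP => w; rewrite !inE => /andP[-> /tr]; apply.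
  by exists z; rewrite !inE zA /= ?rzx ?irr.
by rewrite ltnNge xmin.
Qed.

Section GreedyCorrect.
Variables (L R : finType) (E : {set L * R}) (rL : rel L) (rR : rel R).
Hypotheses (oL : strict_linear_order rL) (oR : strict_linear_order rR).
Implicit Types M : {set L * R}.

Lemma maximal_step M :
  maximal_matching E M -> greedy_step E rL rR M = M.
Proof. by rewrite /greedy_step => ->. Qed.

Lemma matchingP M :
  reflect (M \subset E /\
           {in M &, forall e f, e.1 = f.1 \/ e.2 = f.2 -> e = f})
          (matching E M).
Proof.
apply: (iffP andP) => -[sME dM]; split=> //.
  move=> e f eM fM h; apply/eqP.
  have /forallP/(_ f)/implyP/(_ fM)/implyP := implyP (forallP dM e) eM.
  by apply; case: h => ->; rewrite eqxx ?orbT.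
apply/forallP => e; apply/implyP => eM; apply/forallP => f; apply/implyP => fM.
by apply/implyP => h; apply/eqP/dM => //; case/orP: h => /eqP; [left|right].
Qed.

Lemma matchingU1 M x y : matching E M -> (x, y) \in E ->
  x \notin matchedL M -> y \notin matchedR M -> matching E ((x, y) |: M).
Proof.
move=> /matchingP[sME dM] xyE xM yM.
have n e : e \in M -> ~ (x = e.1 \/ y = e.2).
  by move=> eM [h|h]; [case/negP: xM|case/negP: yM];
     rewrite h; apply: imset_f.
apply/matchingP; split; first by rewrite subUset sub1set xyE.
move=> e f; rewrite !inE => /predU1P[->|eM] /predU1P[->|fM] //.
- by move=> /(n f fM).
- by move=> h; case: (n e eM); case: h => /= ->; [left|right].
exact: dM.
Qed.

Lemma matching_availL M :
  matching E M -> ~~ maximal_matching E M -> availL E M != set0.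
Proof.
move=> mM; apply: contraNneq => noL; apply/maxsetP; split=> // M' mM' sMM'.
apply/eqP; rewrite eqEsubset sMM' andbT; apply/subsetP => -[x y] xyM'.
case/matchingP: mM' => /subsetP sM'E dM'.
have d e : e \in M -> x = e.1 \/ y = e.2 -> (x, y) \in M.
  by move=> eM h; rewrite (dM' (x, y) e) // (subsetP sMM').
have : x \notin availL E M by rewrite noL inE.
rewrite inE negb_and negbK => /orP[/imsetP[e eM ex]|].
  by apply: (d e) => //; left.
move=> /existsPn/(_ y); rewrite sM'E // andbT negbK => /imsetP[e eM ey].
by apply: (d e) => //; right.
Qed.

Lemma greedy_stepP M : matching E M -> ~~ maximal_matching E M ->
  matching E (greedy_step E rL rR M) /\
  #|greedy_step E rL rR M| = #|M|.+1.
Proof.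
move=> mM nmM; rewrite /greedy_step (negbTE nmM).
have [x -> xA] := most_preferred_ex oL (matching_availL mM nmM).
move: xA; rewrite inE => /andP[xM /existsP[y0 /andP[y0M xy0]]].
have [|y -> ] := @most_preferred_ex _ rR [set y in availR E M | (x, y) \in E] oR.
  apply/set0Pn; exists y0; rewrite !inE xy0 y0M /= andbT.
  by apply/existsP; exists x; rewrite xM.
rewrite !inE => /andP[/andP[yM _] xyE]; split; first exact: matchingU1.
by rewrite cardsU1 (contra _ xM) // => xyM; apply/imsetP; exists (x, y).
Qed.

Lemma matching_card M : matching E M -> #|M| <= #|L|.
Proof.
case/matchingP=> _ dM.
rewrite -(card_in_imset (f := fst) (D := mem M)) ?max_card // => e f eM fM ef.
by apply: dM => //; left.
Qed.

Lemma greedy_matching_maximal :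
  maximal_matching E (greedy_matching E rL rR).
Proof.
have m0 : matching E set0.
  by rewrite /matching sub0set; apply/forallP => e; rewrite inE.
have loop n : let M := iter n (greedy_step E rL rR) set0 in
    maximal_matching E M \/ matching E M /\ #|M| = n.
  elim: n => [|n /= [mx|[mM cM]]]; first by right; rewrite cards0.
    by left; rewrite maximal_step.
  set M := iter _ _ _ in mM cM *.
  have [mx|nmx] := boolP (maximal_matching E M).
    by left; rewrite maximal_step.
  by right; have [? ->] := greedy_stepP mM nmx; rewrite cM.
have [//|[mM cM]] := loop #|L|.
rewrite -/(greedy_matching E rL rR) in mM cM *.
apply: contraT => nmx; have [m' c'] := greedy_stepP mM nmx.
by have := matching_card m'; rewrite c' cM ltnn.
Qed.

End GreedyCorrect.

(* Main.v *)
(* The ordering of L is built one vertex at a time, keeping a saturating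
   matching N, of order at most that of M, that contains the greedy matching P
   of the vertices ranked so far.  Let y be the most preferred vertex of R still
   available to P.  Rank next the partner x of y in N or, if N leaves y
   unmatched, any available neighbour x of y; as y is the best vertex available,
   the greedy procedure matches x to y.  The partner of x in N is available, so
   moving x from it to y does not increase the order of N. *)
Require Import Defs.
From mathcomp Require Import all_boot.

Set Implicit Arguments.
Unset Strict Implicit.
Unset Printing Implicit Defensive.

Section StrictLinearOrder.
Variables (T : finType) (r : rel T).
Hypothesis linr : strict_linear_order r.
Implicit Types (A B : {set T}) (x z : T).

Lemma most_preferredP A x :
  reflect (x \in A /\ {in A, forall z, z != x -> r x z})
          (most_preferred r A == Some x).
Proof.
have [irr tr _] := linr.
have pickedP w : reflect {in A, forall z, z != w -> r w z}
                         [forall z in A, (z != w) ==> r w z].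
  by apply: (iffP forall_inP) => best z zA; apply/implyP/best.
rewrite /most_preferred; apply: (iffP eqP) => [|[xA xbest]].
  by case: pickP => // w /andP[wA /pickedP wbest] [<-].
case: pickP => [w /andP[wA /pickedP wbest]|/(_ x) /negP[]]; last first.
  by apply/andP; split=> //; apply/pickedP.
congr Some; apply/eqP; apply: contraT => wx.
have rxx : r x x by apply: tr (xbest w wA wx) (wbest x xA _); rewrite eq_sym.
by rewrite irr in rxx.
Qed.

Lemma most_preferred_subset A B x :
    B \subset A -> x \in B -> most_preferred r A = Some x ->
  most_preferred r B = Some x.
Proof.
move=> /subsetP sBA xB /eqP/most_preferredP[_ xbest].
by apply/eqP/most_preferredP; split=> // z /sBA; apply: xbest.
Qed.

Lemma leq_pref_index x z : r x z -> pref_index r x <= pref_index r z.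
Proof.
have [_ tr _] := linr => rxz; apply/subset_leq_card/subsetP => w; rewrite !inE.
by case/predU1P => [->|/tr/(_ rxz) ->]; rewrite ?rxz orbT.
Qed.

Lemma leq_most_preferred_index A x z :
    most_preferred r A = Some x -> z \in A ->
  pref_index r x <= pref_index r z.
Proof.
move=> /eqP/most_preferredP[_ xbest] zA.
by have [->//|zx] := eqVneq z x; apply/leq_pref_index/xbest.
Qed.

End StrictLinearOrder.

Section ListOrder.
Variable T : eqType.
Implicit Types (s : seq T) (x z : T).

(* As [index x s = size s] for [x] not in [s], all elements of [s] come before
   all others, and the latter are incomparable. *)
Definition list_order s : rel T := fun x z => index x s < index z s.

Lemma list_order_linear s :
  (forall x, x \in s) -> strict_linear_order (list_order s).
Proof.
move=> s_all; split=> [x|y x z|x y]; [exact: ltnn|exact: ltn_trans|].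
by rewrite -neq_ltn; apply: contraNneq => /index_inj->.
Qed.

Lemma list_order_rcons s x : subrel (list_order s) (list_order (rcons s x)).
Proof.
move=> u v uv; rewrite /list_order -cats1 !index_cat.
have us : u \in s by rewrite -index_mem; apply: leq_trans uv (index_size _ _).
by rewrite us; case: ifP => // _; rewrite ltn_addr ?index_mem.
Qed.

Lemma list_order_last s x z :
  x \notin s -> z \notin rcons s x -> list_order (rcons s x) x z.
Proof.
move=> xs zsx; rewrite /list_order (memNindex zsx) size_rcons.
by rewrite -cats1 index_cat (negbTE xs) /= eqxx addn0.
Qed.

End ListOrder.

Section Matchings.
Variables (L R : finType) (E : {set L * R}).
Implicit Types (M N P : {set L * R}) (x : L) (y : R) (rR : rel R).

Lemma matchedLP M x : reflect (exists y, (x, y) \in M) (x \in matchedL M).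
Proof.
apply: (iffP imsetP) => [[[x' y] eM /= ->]|[y xyM]]; first by exists y.
by exists (x, y).
Qed.

Lemma matchedRP M y : reflect (exists x, (x, y) \in M) (y \in matchedR M).
Proof.
apply: (iffP imsetP) => [[[x y'] eM /= ->]|[x xyM]]; first by exists x.
by exists (x, y).
Qed.

Lemma matchedLU1 M x y : matchedL ((x, y) |: M) = x |: matchedL M.
Proof. exact: imsetU1. Qed.

Lemma saturating_card M : saturating M = (#|L| <= #|matchedL M|).
Proof.
have <- : (matchedL M == setT) = (#|L| <= #|matchedL M|).
  by rewrite eqEcard subsetT cardsT.
by apply/forallP/eqP => [satM|-> //]; apply/setP => x; rewrite satM inE.
Qed.

Lemma matching_subset M N : matching E M -> N \subset M -> matching E N.
Proof.
move=> /matchingP[sME dM] sNM; apply/matchingP; split.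
  exact: subset_trans sNM sME.
by move=> e f /(subsetP sNM) eM /(subsetP sNM) fM; apply: dM.
Qed.

Lemma matching_edge M e : matching E M -> e \in M -> e \in E.
Proof. by move=> /matchingP[/subsetP sME _] /sME. Qed.

Lemma matching_funL M x y y' :
  matching E M -> (x, y) \in M -> (x, y') \in M -> y = y'.
Proof.
by move=> /matchingP[_ dM] xyM xy'M; case: (dM _ _ xyM xy'M (or_introl erefl)).
Qed.

Lemma matching_funR M x x' y :
  matching E M -> (x, y) \in M -> (x', y) \in M -> x = x'.
Proof.
by move=> /matchingP[_ dM] xyM x'yM; case: (dM _ _ xyM x'yM (or_intror erefl)).
Qed.

Lemma submatching_matchedLR N P x y :
    matching E N -> P \subset N -> (x, y) \in N ->
  (x \in matchedL P) = (y \in matchedR P).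
Proof.
move=> mN /subsetP sPN xyN.
apply/matchedLP/matchedRP => [[y' xy'P]|[x' x'yP]].
  by exists x; rewrite (matching_funL mN xyN (sPN _ xy'P)).
by exists y; rewrite (matching_funR mN xyN (sPN _ x'yP)).
Qed.

Lemma unmatched_beyondP rR M k :
  reflect {in M, forall e, pref_index rR e.2 <= k} (unmatched_beyond rR M k).
Proof.
apply: (iffP forallP) => [beyond e eM|within y].
  by rewrite leqNgt; apply: contraL (imset_f snd eM); apply/implyP/beyond.
by rewrite ltnNge -implybNN !negbK; apply/implyP => /imsetP[e /within ? ->].
Qed.

Lemma matching_order_leP rR M k :
  reflect (saturating M /\ {in M, forall e, pref_index rR e.2 <= k})
          (le_ext (matching_order rR M) (Some k)).
Proof.
rewrite /matching_order; case: ifP => [satM|_] /=; last by constructor; case.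
case: ex_minnP => j /unmatched_beyondP withinj jmin.
apply: (iffP idP) => [jk|[_ withink]]; last exact/jmin/unmatched_beyondP.
by split=> // e /withinj /leq_trans; apply.
Qed.

Lemma matching_order_saturating rR M N :
    le_ext (matching_order rR N) (matching_order rR M) ->
  saturating M -> saturating N.
Proof.
move=> leNM satM; move: leNM; rewrite [matching_order rR M]/matching_order satM.
by case/matching_order_leP.
Qed.

Lemma matching_order_subset rR P N k :
    P \subset N -> saturating P -> le_ext (matching_order rR N) (Some k) ->
  le_ext (matching_order rR P) (Some k).
Proof.
move=> /subsetP sPN satP /matching_order_leP[_ Nk].
by apply/matching_order_leP; split=> // e /sPN/Nk.
Qed.

Definition unmatch N x : {set L * R} := [set e in N | e.1 != x].

Definition rematch N x y : {set L * R} := (x, y) |: unmatch N x.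

Lemma unmatch_subset N x : unmatch N x \subset N.
Proof. by apply/subsetP => e; rewrite inE => /andP[]. Qed.

Lemma matching_rematch N x y :
    matching E N -> (x, y) \in E -> y \notin matchedR (unmatch N x) ->
  matching E (rematch N x y).
Proof.
move=> mN xyE yN; apply: matchingU1 => //.
  exact: matching_subset mN (unmatch_subset N x).
by apply/matchedLP => -[y']; rewrite inE eqxx andbF.
Qed.

Lemma subset_rematch P N x y :
    P \subset N -> x \notin matchedL P -> (x, y) |: P \subset rematch N x y.
Proof.
move=> /subsetP sPN xP; apply/setUS/subsetP => e eP; rewrite inE sPN //=.
by apply: contraNneq xP => <-; apply: imset_f.
Qed.

Lemma saturating_rematch N x y : saturating N -> saturating (rematch N x y).
Proof.
move=> /forallP satN; apply/forallP => z; rewrite matchedLU1 in_setU1.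
have [//|zx] := eqVneq z x; have /matchedLP[y' zy'N] := satN z.
by apply/matchedLP; exists y'; rewrite inE zy'N.
Qed.

Lemma matching_order_rematch rR N x y k :
    le_ext (matching_order rR N) (Some k) -> pref_index rR y <= k ->
  le_ext (matching_order rR (rematch N x y)) (Some k).
Proof.
move=> /matching_order_leP[satN Nk] yk; apply/matching_order_leP.
split; first exact: saturating_rematch.
by move=> e /setU1P[->|/(subsetP (unmatch_subset N x))/Nk].
Qed.

Lemma availL_not_maximal P x :
  matching E P -> x \in availL E P -> ~~ maximal_matching E P.
Proof.
move=> mP; rewrite inE => /andP[xP /existsP[y /andP[yP xyE]]].
apply: contraNN (xP) => /maxsetP[_ maxP].
by rewrite -(maxP _ (matchingU1 mP xyE xP yP) (subsetUr _ _)) matchedLU1 setU11.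
Qed.

Lemma partner_available P N x y :
    matching E N -> P \subset N -> (x, y) \in N -> x \notin matchedL P ->
  y \in availR E P.
Proof.
move=> mN sPN xyN xP; rewrite inE -(submatching_matchedLR mN sPN xyN) xP.
by apply/existsP; exists x; rewrite xP (matching_edge mN).
Qed.

Lemma available_rematch P N y :
    matching E N -> P \subset N -> y \in availR E P ->
  exists x, [/\ x \notin matchedL P, (x, y) \in E
              & y \notin matchedR (unmatch N x)].
Proof.
move=> mN sPN; rewrite inE => /andP[yP /existsP[x /andP[xP xyE]]].
have [/matchedRP[z zyN]|yN] := boolP (y \in matchedR N).
  exists z; split; rewrite ?(submatching_matchedLR mN sPN zyN) //.
    exact: matching_edge zyN.
  apply/matchedRP => -[w]; rewrite inE => /andP[wyN /eqP[]].
  exact: matching_funR wyN zyN.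
exists x; split=> //.
by apply: contra yN; apply/subsetP/imsetS/unmatch_subset.
Qed.

End Matchings.

Section Greedy.
Variables (L R : finType) (E : {set L * R}) (rR : rel R).
Hypothesis linR : strict_linear_order rR.
Implicit Types (N P : {set L * R}) (x : L) (y : R) (s : seq L).

Definition completable k P : Prop :=
  exists N, [/\ P \subset N, matching E N
              & le_ext (matching_order rR N) (Some k)].

Lemma completable_matching k P : completable k P -> matching E P.
Proof. by case=> N [sPN mN _]; apply: matching_subset mN sPN. Qed.

Lemma completable_order k P :
    completable k P -> saturating P ->
  le_ext (matching_order rR P) (Some k).
Proof. by case=> N [sPN _ Nk] satP; apply: matching_order_subset Nk. Qed.

Lemma completable_extend k P :
    completable k P -> ~~ saturating P ->
  exists x y, [/\ x \notin matchedL P, most_preferred rR (availR E P) = Some y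
                & completable k ((x, y) |: P)].
Proof.
move=> [N [sPN mN Nk]] /forallPn[x0 x0P].
have [/forallP satN indexN] := matching_order_leP _ _ _ Nk.
have availP x : x \notin matchedL P ->
    exists2 y, (x, y) \in N & y \in availR E P.
  have /matchedLP[y xyN] := satN x.
  by exists y => //; apply: partner_available xyN _.
have [y bestP yP] : exists2 y, most_preferred rR (availR E P) = Some y
                             & y \in availR E P.
  apply: most_preferred_ex => //; apply/set0Pn.
  by have [y0 _ y0P] := availP x0 x0P; exists y0.
have [x [xP xyE yN]] := available_rematch mN sPN yP.
have [y' xy'N y'P] := availP x xP.
have yk : pref_index rR y <= k.
  exact: leq_trans (leq_most_preferred_index linR bestP y'P) (indexN _ xy'N).
exists x, y; split=> //; exists (rematch N x y); split.
- exact: subset_rematch.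
- exact: matching_rematch.
- exact: matching_order_rematch.
Qed.

Lemma greedy_step_best (rL : rel L) P x y :
    matching E P -> strict_linear_order rL ->
    most_preferred rL (availL E P) = Some x ->
    most_preferred rR (availR E P) = Some y -> (x, y) \in E ->
  greedy_step E rL rR P = (x, y) |: P.
Proof.
move=> mP linL bestx besty xyE.
have /eqP/(most_preferredP linL)[xP _] := bestx.
have /eqP/(most_preferredP linR)[yP _] := besty.
rewrite /greedy_step (negbTE (availL_not_maximal mP xP)) bestx.
rewrite (most_preferred_subset linR _ _ besty) //; last by rewrite inE yP.
by apply/subsetP => z; rewrite inE => /andP[].
Qed.

Definition greedy_builds s P : Prop :=
  [/\ uniq s, matchedL P = [set x in s]
    & forall rL, strict_linear_order rL -> subrel (list_order s) rL ->
        iter (size s) (greedy_step E rL rR) set0 = P].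

Lemma greedy_builds_nil : greedy_builds [::] set0.
Proof.
split=> //; apply/setP => x; rewrite inE.
by apply/matchedLP => -[y]; rewrite inE.
Qed.

Lemma greedy_builds_card s P : greedy_builds s P -> #|matchedL P| = size s.
Proof. by case=> us -> _; rewrite cardsE; apply/card_uniqP. Qed.

Lemma greedy_builds_rcons s P x y :
    greedy_builds s P -> matching E ((x, y) |: P) -> x \notin matchedL P ->
    most_preferred rR (availR E P) = Some y ->
  greedy_builds (rcons s x) ((x, y) |: P).
Proof.
move=> [us Ps run] mxyP xP besty.
have xs : x \notin s by move: xP; rewrite Ps inE.
have xyE : (x, y) \in E by apply: matching_edge mxyP _; rewrite setU11.
split; first by rewrite rcons_uniq xs.
  by rewrite matchedLU1 Ps; apply/setP => z; rewrite !inE mem_rcons.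
move=> rL linL sub_rL; rewrite size_rcons iterS run //; last first.
  by move=> u v uv; apply/sub_rL/list_order_rcons.
apply: greedy_step_best => //; first exact: matching_subset mxyP (subsetUr _ _).
apply/eqP/(most_preferredP linL); split=> [|z].
  rewrite inE xP; apply/existsP; exists y; rewrite xyE andbT.
  by have /eqP/(most_preferredP linR)[] := besty; rewrite inE => /andP[].
rewrite inE Ps inE => /andP[zs _] zx; apply/sub_rL/list_order_last => //.
by rewrite mem_rcons inE negb_or zx.
Qed.

Lemma completable_greedy_builds k n :
    completable k set0 -> n <= #|L| ->
  exists s P, [/\ size s = n, greedy_builds s P & completable k P].
Proof.
move=> compl0; elim: n => [_|n IHn ltnL].
  by exists [::], set0; split=> //; apply: greedy_builds_nil.
have [s [P [szs buildP complP]]] := IHn (ltnW ltnL).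
have nsatP : ~~ saturating P.
  by rewrite saturating_card (greedy_builds_card buildP) szs -ltnNge.
have [x [y [xP besty complxyP]]] := completable_extend complP nsatP.
exists (rcons s x), ((x, y) |: P); split=> //; first by rewrite size_rcons szs.
exact: greedy_builds_rcons (completable_matching complxyP) _ _.
Qed.

Lemma greedy_builds_saturating s P :
    greedy_builds s P -> saturating P ->
  strict_linear_order (list_order s) /\
  greedy_matching E (list_order s) rR = P.
Proof.
move=> buildP satP; have [us Ps run] := buildP.
have lin_s : strict_linear_order (list_order s).
  by apply: list_order_linear => x; have := forallP satP x; rewrite Ps inE.
split=> //; rewrite /greedy_matching -[RHS](run _ lin_s) //; congr iter.
apply/eqP; rewrite eqn_leq -(greedy_builds_card buildP) max_card andbT.
by rewrite -saturating_card.
Qed.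

Lemma completable_greedy_matching k :
    completable k set0 ->
  exists2 rL : rel L, strict_linear_order rL
    & le_ext (matching_order rR (greedy_matching E rL rR)) (Some k).
Proof.
move=> /completable_greedy_builds/(_ (leqnn #|L|))[s [P [szs buildP complP]]].
have satP : saturating P.
  by rewrite saturating_card (greedy_builds_card buildP) szs.
have [lin_s greedyP] := greedy_builds_saturating buildP satP.
by exists (list_order s); rewrite // greedyP; apply: completable_order.
Qed.

End Greedy.

Theorem theorem2 (L R : finType) (E : {set L * R}) (rR : rel R)
    (linR : strict_linear_order rR)
    (M : {set L * R}) (hM : matching E M) :
  exists rL : rel L,
    [/\ strict_linear_order rL,
        le_ext (matching_order rR (greedy_matching E rL rR))
               (matching_order rR M)
      & saturating M -> saturating (greedy_matching E rL rR)].
Proof.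
suff [rL linL le_order] : exists2 rL : rel L, strict_linear_order rL
    & le_ext (matching_order rR (greedy_matching E rL rR))
             (matching_order rR M).
  by exists rL; split=> //; apply: matching_order_saturating le_order.
case orderM: (matching_order rR M) => [k|].
  apply: completable_greedy_matching => //.
  by exists M; split; rewrite ?sub0set // orderM /=.
exists (list_order (enum L)); last by case: matching_order.
by apply: list_order_linear => x; rewrite mem_enum.
Qed.
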